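(* If a digraph $H$ is bicomplete, then $H$ is a panchromatic pattern.
   Context: A digraph $D=(V(D),A(D))$ consists of a finite non-empty set $V(D)$ of vertices and a set $A(D)\subseteq V(D)\times V(D)$ of arcs (loops $(x,x)$ are allowed). A digraph is looped if $(x,x)$ is an arc for every vertex $x$. Given digraphs $D$ and $H$, an $H$-colouring of $D$ is a map $\varsigma\colon A(D)\to V(H)$. Given such a colouring, a walk $x_0,x_1,\dots,x_k$ in $D$ (so $(x_{i-1},x_i)\in A(D)$ for $1\le i\le k$) is an $H$-walk if the sequence $\varsigma(x_0,x_1),\varsigma(x_1,x_2),\dots,\varsigma(x_{k-1},x_k)$ is a walk in $H$, i.e. any two consecutive colours $c,c'$ in it satisfy $(c,c')\in A(H)$; in particular a single arc of $D$ is always an $H$-walk. A set $K\subseteq V(D)$ is an $H$-kernel of $D$ (with respect to the colouring) if there is no $H$-walk from one vertex of $K$ to a different vertex of $K$, and for every vertex $v\in V(D)\setminus K$ there is an $H$-walk from $v$ to some vertex of $K$. A digraph $H$ is a panchromatic pattern if for every digraph $D$ and every $H$-colouring of $D$ there exists an $H$-kernel of $D$. A looped digraph $H$ is bicomplete if $V(H)$ is a disjoint union $X\sqcup Y$ (one of the parts may be empty) such that the induced subdigraphs $H[X]$ and $H[Y]$ are complete (all arcs in both directions between distinct vertices are present) and $(y,x)\in A(H)$ for all $x\in X$, $y\in Y$. Some, none or all of the arcs $(x,y)$ with $x\in X$, $y\in Y$ may belong to $A(H)$. *)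

(* Defs.v *)
From mathcomp Require Import all_boot.

Set Implicit Arguments.
Unset Strict Implicit.
Unset Printing Implicit Defensive.

Record digraph := Digraph {
  vertex :> finType;
  arc : rel vertex;
  vertex_nonempty : 0 < #|vertex|
}.

Definition arcs (D : digraph) : Type := {e : D * D | arc e.1 e.2}.

Definition looped (D : digraph) : Prop := forall x : D, arc x x.

Definition colouring (D H : digraph) : Type := arcs D -> H.

(* The walk x_0, x_1, ..., x_k is encoded by its first vertex [x] and the
   sequence [s] of the remaining ones, as in [path]. The [zip] lists the pairs
   (x_(i-1), x_i); pairs that are not arcs carry no colour and are dropped by
   [pmap], which does not happen when [path (@arc D) x s] holds. *)
Definition walk_colours (D H : digraph) (c : colouring D H) (x : D)
    (s : seq D) : seq H :=
  pmap (fun e : D * D => omap c (insub e : option (arcs D))) (zip (x :: s) s).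

Definition Hwalk (D H : digraph) (c : colouring D H) (x : D) (s : seq D) : bool :=
  path (@arc D) x s && sorted (@arc H) (walk_colours c x s).

(* Walks of length 0 are allowed here; [Hkernel] only uses this relation
   between distinct vertices, where they play no role. *)
Definition Hreach (D H : digraph) (c : colouring D H) (x y : D) : Prop :=
  exists2 s : seq D, Hwalk c x s & last x s = y.

Definition Hkernel (D H : digraph) (c : colouring D H) (K : {set D}) : Prop :=
  (forall u v : D, u \in K -> v \in K -> u <> v -> ~ Hreach c u v) /\
  (forall v : D, v \notin K -> exists2 u : D, u \in K & Hreach c v u).

Definition panchromatic_pattern (H : digraph) : Prop :=
  forall (D : digraph) (c : colouring D H), exists K : {set D}, Hkernel c K.

Definition complete_on (H : digraph) (X : {set H}) : Prop :=
  forall x y : H, x \in X -> y \in X -> x <> y -> arc x y.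

Definition bicomplete (H : digraph) : Prop :=
  looped H /\
  exists X Y : {set H},
    [/\ X :|: Y = [set: H], [disjoint X & Y],
        complete_on X, complete_on Y &
        forall x y : H, x \in X -> y \in Y -> arc y x].

(* Main.v *)
Require Import Defs.
From mathcomp Require Import all_boot.
From mathcomp Require Import boolp.
(* Makes [arc] the arc relation again, rather than [path.arc]. *)
Import Defs.

(** In a bicomplete pattern every colour of one part, Y, has an arc to all
    colours, and every colour of the other part, X, has an arc from all
    colours ([bicomplete_universal]).  Call a colour sequence left-free if
    every walk of H may be put before it, and right-free if every walk of H may
    be put after it.  Cutting an H-walk just after its last colour from Y gives a
    right-free part followed by a left-free part ([sorted_split]), and
    conversely such a concatenation is always an H-walk.  Since right-free
    walks compose, and so do left-free ones, reachability by H-walks is the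
    composite E ; F of two preorders ([HreachP]).

    It remains to see that the composite of two preorders E and F on a finite
    set has a kernel ([composite_kernel]), by induction on the set.  Take an
    F-maximal element t and its F-class C.
    - If some s in C has all its E-successors in C, then s reaches only C, all
      of which reaches s: put s in the kernel, discard everything that reaches
      s, and add a kernel of the rest.
    - Otherwise each element of C has an E-successor outside C.  A kernel of
      the complement of C then absorbs C too, because E can be prefixed to E ; F,
      and no connection is lost by discarding C, which F never leaves. *)

Set Implicit Arguments.
Unset Strict Implicit.
Unset Printing Implicit Defensive.

(** * Kernels of composites of two preorders *)

Section CompositeOfPreorders.

Variables (T : finType) (E F : rel T).
Hypotheses (Erefl : reflexive E) (Etrans : transitive E).
Hypotheses (Frefl : reflexive F) (Ftrans : transitive F).

(** Successor sets shrink along F, so an element with the fewest F-successors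
    inside A is maximal. *)
Lemma exists_maximal (A : {set T}) (x : T) : x \in A ->
  exists2 t, t \in A & forall y, y \in A -> F t y -> F y t.
Proof.
move=> xA; pose up y := [set z in A | F y z].
case: (arg_minnP (fun y => #|up y|) xA) => t tA tmin.
exists t => // y yA Fty.
have sub : up y \subset up t.
  by apply/subsetP=> z; rewrite !inE => /andP[-> /(Ftrans Fty)].
have /eqP eq_up : up y == up t by rewrite eqEcard sub tmin.
have : t \in up t by rewrite inE Frefl andbT.
by rewrite -eq_up inE => /andP[].
Qed.

(** The intermediate point is required to stay in A, so that the statement
    about A only speaks of E and F restricted to A and is fit for induction. *)
Definition composite (A : {set T}) (u v : T) : bool :=
  [exists w in A, E u w && F w v].

Lemma compositeP (A : {set T}) u v :
  reflect (exists w, [/\ w \in A, E u w & F w v]) (composite A u v).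
Proof.
apply: (iffP exists_inP) => [[w wA /andP[Euw Fwv]]|[w [wA Euw Fwv]]];
  by exists w => //; rewrite Euw.
Qed.

Lemma composite_refl (A : {set T}) u : u \in A -> composite A u u.
Proof. by move=> uA; apply/compositeP; exists u. Qed.

Lemma composite_prefix (A : {set T}) u v w :
  E u v -> composite A v w -> composite A u w.
Proof.
move=> Euv /compositeP[x [xA Evx Fxw]]; apply/compositeP; exists x.
by split=> //; apply: Etrans Evx.
Qed.

Lemma compositeS (A B : {set T}) u v :
  B \subset A -> composite B u v -> composite A u v.
Proof.
move=> /subsetP BA /compositeP[w [/BA wA Euw Fwv]].
by apply/compositeP; exists w.
Qed.

(** Absorption is asked of the elements of K as well: each is absorbed by
    itself, the composite being reflexive. *)
Definition composite_kernel_of (A K : {set T}) : Prop :=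
  [/\ K \subset A, {in K &, forall u v, composite A u v -> u = v}
    & forall v, v \in A -> exists2 k, k \in K & composite A v k].

Theorem composite_kernel (A : {set T}) : exists K, composite_kernel_of A K.
Proof.
have [n] := ubnP #|A|; elim: n => // n IHn in A *; rewrite ltnS => leAn.
have IH t (B : {set T}) : t \in A -> t \notin B -> B \subset A ->
    exists K, composite_kernel_of B K.
  move=> tA tNB BA; apply: IHn; apply: leq_trans leAn; apply: proper_card.
  by rewrite properE BA; apply/subsetPn; exists t.
have [->|[x /exists_maximal[t tA tmax]]] := set_0Vmem A.
  exists set0; split=> [|u v|v]; rewrite ?sub0set ?inE //.
pose C := [set y in A | F t y].
have tC : t \in C by rewrite inE tA Frefl.
have CF y z : y \in C -> z \in A -> F y z -> z \in C.
  by rewrite !inE => /andP[_ Fty] -> /(Ftrans Fty).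
have CFC y z : y \in C -> z \in C -> F y z.
  by rewrite !inE => /andP[yA /(tmax _ yA) Fyt] /andP[_]; apply: Ftrans Fyt.
have [/existsP[s /andP[sC /forall_inP EsC]]|noTrap] :=
  boolP [exists s, (s \in C) && [forall w in A, E s w ==> (w \in C)]].
- have sA : s \in A by move: sC; rewrite inE => /andP[].
  pose B := [set v in A | ~~ composite A v s].
  have BA : B \subset A by apply/subsetP=> v; rewrite inE => /andP[].
  have [|K [KB Kind Kabs]] := IH s B sA _ BA.
    by rewrite inE composite_refl ?andbF.
  have K_A u : u \in K -> u \in A by move/(subsetP KB)/(subsetP BA).
  have K_s u : u \in K -> ~~ composite A u s.
    by move/(subsetP KB); rewrite inE => /andP[].
  have s_K u : u \in K -> ~~ composite A s u.
    move=> uK; apply: contra (K_s _ uK) => /compositeP[w [wA Esw Fwu]].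
    have wC : w \in C by move: (EsC w wA); rewrite Esw.
    have uC : u \in C by apply: CF Fwu => //; apply: K_A.
    by apply/compositeP; exists u; split; rewrite ?K_A //; apply: CFC.
  (* A connection inside A between vertices that do not reach s also has its
     intermediate point outside the set of vertices reaching s. *)
  have AB u v : u \in B -> composite A u v -> composite B u v.
    rewrite inE => /andP[_ Nus] /compositeP[w [wA Euw Fwv]].
    apply/compositeP; exists w; split=> //; rewrite inE wA.
    by apply: contra Nus; apply: composite_prefix.
  exists (s |: K); split.
  + by rewrite subUset sub1set sA; apply/subsetP.
  + move=> u v; rewrite !inE => /orP[/eqP->|uK] /orP[/eqP->|vK] //.
    * by move/negP: (s_K _ vK).
    * by move/negP: (K_s _ uK).
    * by move/(AB _ _ (subsetP KB _ uK)); apply: Kind.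
  + move=> v vA; have [vs|Nvs] := boolP (composite A v s).
      by exists s; rewrite ?setU11.
    have [|k kK vk] := Kabs v; first by rewrite inE vA.
    by exists k; [rewrite inE kK orbT | apply: compositeS vk].
- pose B := A :\: C.
  have BA : B \subset A by apply: subsetDl.
  have [|K [KB Kind Kabs]] := IH t B tA _ BA; first by rewrite inE tC.
  exists K; split.
  + exact: subset_trans BA.
  + move=> u v uK vK /compositeP[w [wA Euw Fwv]].
    apply: Kind => //; apply/compositeP; exists w; split=> //.
    have := subsetP KB _ vK; rewrite !(in_setD, wA) andbT => /andP[vNC vA].
    by apply: contra vNC => wC; apply: CF Fwv.
  + move=> v vA; have [vC|vNC] := boolP (v \in C); last first.
      have [|k kK vk] := Kabs v; first by rewrite inE vNC.
      by exists k => //; apply: compositeS vk.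
    move: noTrap; rewrite negb_exists => /forallP/(_ v); rewrite vC negb_forall_in.
    case/exists_inP=> w wA; rewrite negb_imply => /andP[Evw wNC].
    have [|k kK wk] := Kabs w; first by rewrite inE wNC.
    by exists k => //; apply: composite_prefix Evw _; apply: compositeS wk.
Qed.

End CompositeOfPreorders.

(** * Splitting H-walks *)

Section FreeSequences.

Variable H : digraph.

Definition right_free (cs : seq H) : Prop :=
  forall cs' : seq H, sorted (@arc H) cs' -> sorted (@arc H) (cs ++ cs').

Definition left_free (cs : seq H) : Prop :=
  forall cs' : seq H, sorted (@arc H) cs' -> sorted (@arc H) (cs' ++ cs).

Lemma right_free_cat a b : right_free a -> right_free b -> right_free (a ++ b).
Proof. by move=> fa fb cs /fb/fa; rewrite catA. Qed.

Lemma left_free_cat a b : left_free a -> left_free b -> left_free (a ++ b).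
Proof. by move=> fa fb cs /fa/fb; rewrite catA. Qed.

(** The loops, the completeness of the parts and the arcs from Y to X give a
    colour of Y the first property and a colour of X the second. *)
Lemma bicomplete_universal (h : H) : bicomplete H ->
  (forall k : H, arc h k) \/ (forall k : H, arc k h).
Proof.
move=> [loopH [X [Y [XY _ cX cY YX]]]].
have inXY k : k \in X \/ k \in Y by apply/orP; rewrite -in_setU XY inE.
have complete_arc (Z : {set H}) : complete_on Z ->
    forall k l : H, k \in Z -> l \in Z -> arc k l.
  by move=> cZ k l kZ lZ; have [->//|/eqP] := eqVneq k l; apply: cZ.
case: (inXY h) => [hX|hY]; [right|left] => k; case: (inXY k) => [kX|kY].
- exact: (complete_arc X).
- exact: YX.
- exact: YX.
- exact: (complete_arc Y).
Qed.

(** It suffices to cut just after the last colour that has an arc to every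
    colour, since each remaining colour then has an arc from every colour.
    Read from the right, the cut stays put once the first part is non-empty. *)
Lemma sorted_split (cs : seq H) : bicomplete H -> sorted (@arc H) cs ->
  exists a b, [/\ cs = a ++ b, right_free a & left_free b].
Proof.
move=> bH; elim: cs => [|h cs IH] hcs.
  by exists [::], [::]; split=> // cs; rewrite cats0.
have [[|k a] [b [def_cs fa fb]]] := IH (path_sorted hcs).
- have [to_all|from_all] := bicomplete_universal h bH.
    exists [:: h], b; split=> //=; first by rewrite def_cs.
    by case=> //= k cs'; rewrite to_all.
  exists [::], (h :: cs); split=> //.
  by case=> //= k cs' kcs'; rewrite cat_path /= from_all kcs'.
- exists (h :: k :: a), b; split=> //; first by rewrite def_cs.
  move=> cs' /fa /= ->; rewrite andbT.
  by move: hcs; rewrite def_cs /= => /andP[].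
Qed.

End FreeSequences.

Section Reachability.

Variables (D H : digraph) (c : colouring D H).

Lemma walk_colours_cat x s1 s2 :
  walk_colours c x (s1 ++ s2) =
  walk_colours c x s1 ++ walk_colours c (last x s1) s2.
Proof.
elim: s1 x => [|y s1 IH] x //=.
by rewrite /walk_colours /= -!/(walk_colours c _ _) IH; case: (omap _ _).
Qed.

Lemma walk_colours_cons x y : arc x y ->
  exists h, forall s, walk_colours c x (y :: s) = h :: walk_colours c y s.
Proof.
move=> xy; exists (c (exist _ (x, y) xy)) => s.
rewrite /walk_colours /= -/(walk_colours c y s).
by rewrite (insubT (fun e : D * D => arc e.1 e.2) (x := (x, y)) xy).
Qed.

Lemma walk_colours_split x s a b :
    path (@arc D) x s -> walk_colours c x s = a ++ b ->
  exists s1 s2, [/\ s = s1 ++ s2, walk_colours c x s1 = a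
                  & walk_colours c (last x s1) s2 = b].
Proof.
elim: a x s => [|h a IH] x s; first by exists [::], s.
case: s => [|y s] //= /andP[/walk_colours_cons[k col_y] ys].
rewrite col_y => -[<- /(IH _ _ ys)[s1 [s2 [-> <- <-]]]].
by exists (y :: s1), s2.
Qed.

(** With [free] taken as [right_free] and [left_free], these are the preorders
    E and F. *)
Definition reach_with (free : seq H -> Prop) (u v : D) : Prop :=
  exists s, [/\ path (@arc D) u s, last u s = v & free (walk_colours c u s)].

Lemma reach_with_refl (free : seq H -> Prop) u : free [::] -> reach_with free u u.
Proof. by move=> free0; exists [::]. Qed.

Lemma reach_with_trans (free : seq H -> Prop) u v w :
    (forall a b, free a -> free b -> free (a ++ b)) ->
  reach_with free u v -> reach_with free v w -> reach_with free u w.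
Proof.
move=> free_cat [s1 [p1 <- f1]] [s2 [p2 <- f2]]; exists (s1 ++ s2).
by rewrite cat_path p1 last_cat walk_colours_cat; split=> //; apply: free_cat.
Qed.

Lemma HreachP u v : bicomplete H ->
  Hreach c u v <->
  exists2 w, reach_with (@right_free H) u w & reach_with (@left_free H) w v.
Proof.
move=> bH; split.
  move=> [s /andP[us sorted_s] <-].
  have [a [b [def_cs fa fb]]] := sorted_split bH sorted_s.
  have [s1 [s2 [def_s def_a def_b]]] := walk_colours_split us def_cs.
  move: us; rewrite def_s cat_path last_cat => /andP[us1 us2].
  by exists (last u s1); [exists s1; rewrite def_a | exists s2; rewrite def_b].
move=> [w [s1 [p1 <- f1]] [s2 [p2 <- f2]]]; exists (s1 ++ s2).
  rewrite /Hwalk cat_path p1 p2 walk_colours_cat /=.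
  by apply: f1; apply: (f2 [::]).
by rewrite last_cat.
Qed.

End Reachability.

Theorem lemma7 (H : digraph) (hH : bicomplete H) : panchromatic_pattern H.
Proof.
move=> D c.
pose E : rel D := fun u v => `[< reach_with c (@right_free H) u v >].
pose F : rel D := fun u v => `[< reach_with c (@left_free H) u v >].
have Erefl : reflexive E by move=> u; apply/asboolP; apply: reach_with_refl.
have Frefl : reflexive F.
  by move=> u; apply/asboolP; apply: reach_with_refl => cs; rewrite cats0.
have Etrans : transitive E.
  move=> v u w /asboolP uv /asboolP vw; apply/asboolP.
  by apply: reach_with_trans uv vw; apply: right_free_cat.
have Ftrans : transitive F.
  move=> v u w /asboolP uv /asboolP vw; apply/asboolP.
  by apply: reach_with_trans uv vw; apply: left_free_cat.
have reachE u v : Hreach c u v <-> composite E F [set: D] u v.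
  rewrite HreachP //; split.
    move=> [w /asboolP Euw /asboolP Fwv]; apply/compositeP; exists w.
    by rewrite inE.
  by move=> /compositeP[w [_ /asboolP uw /asboolP wv]]; exists w.
have [K [_ Kind Kabs]] := composite_kernel Erefl Etrans Frefl Ftrans [set: D].
exists K; split=> [u v uK vK neq_uv /reachE uv|v _].
  by apply: neq_uv; apply: Kind.
by have [//|u uK /reachE] := Kabs v; exists u.
Qed.
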